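(* Let $a$ and $d$ be positive integers with $d>1$, and let $n\ge 0$ be an integer. Then there exists an oriented bipartite graph with score set $A=\{a, ad, ad^2,\dots, ad^n\}$.
   Context: An oriented bipartite graph $D(U,V)$ is obtained by assigning a direction to each edge of a simple bipartite graph with parts $U=\{u_1,\dots,u_m\}$ and $V=\{v_1,\dots,v_n\}$. For a vertex $x$, let $d_x^+$ and $d_x^-$ denote its outdegree and indegree. The score of $u\in U$ is $a_u=n+d_u^+-d_u^-$ and the score of $v\in V$ is $b_v=m+d_v^+-d_v^-$. The score set of $D(U,V)$ is the set of distinct scores of all its vertices. *)

(* Defs.v *)
From mathcomp Require Import all_boot all_order all_algebra.
Set Implicit Arguments.
Unset Strict Implicit.
Unset Printing Implicit Defensive.
Import GRing.Theory.
Local Open Scope ring_scope.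

(* The underlying simple bipartite graph joins u and v when one of arcUV u v,
   arcVU v u holds; an edge has exactly one direction. *)
Record oriented_bigraph (U V : finType) := OrientedBigraph {
  arcUV : U -> V -> bool;
  arcVU : V -> U -> bool;
  arc_asym : forall u v, ~~ (arcUV u v && arcVU v u)
}.

Section Scores.
Variables (U V : finType) (D : oriented_bigraph U V).

Definition outdegU (u : U) : nat := #|[set v | arcUV D u v]|.
Definition indegU (u : U) : nat := #|[set v | arcVU D v u]|.
Definition outdegV (v : V) : nat := #|[set u | arcVU D v u]|.
Definition indegV (v : V) : nat := #|[set u | arcUV D u v]|.

Definition scoreU (u : U) : int := #|V|%:Z + (outdegU u)%:Z - (indegU u)%:Z.
Definition scoreV (v : V) : int := #|U|%:Z + (outdegV v)%:Z - (indegV v)%:Z.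

Definition score_set : seq int :=
  undup ([seq scoreU u | u : U] ++ [seq scoreV v | v : V]).

End Scores.

(* Main.v *)
(** Stack dominating layers.  Given a graph on p + q vertices, add s - 2p
    vertices to U and s - 2q to V, each new vertex dominating all old vertices
    of the other part and being non-adjacent to the new ones.  Old scores do not
    change (a new vertex adds 1 to the part size and 1 to the indegree) and every
    new vertex has score s.  The new part sizes p' = s - p and q' = s - q satisfy
    2p', 2q' <= d s, so the step can be iterated with s = a d, a d^2, ...,
    starting from the arcless graph on a + a vertices.  The step adds at least
    one vertex iff p + q < s, and then p' + q' < 2 s <= d s, so this condition
    persists too.  It fails only at the first step for d = 2, where one instead
    adds a vertices to U and none to V. *)
Require Import Defs.
From mathcomp Require Import all_boot all_order all_algebra.
From mathcomp Require Import zify.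

Lemma card_set_split (m n : nat) (P : pred 'I_(m + n)) :
  #|[set i | P i]| =
  #|[set i | P (lshift n i)]| + #|[set i | P (rshift m i)]|.
Proof. by rewrite !cardsE -!sum1_card big_split_ord. Qed.

Lemma eq_card_set (T : finType) (P Q : pred T) :
  P =1 Q -> #|[set i | P i]| = #|[set i | Q i]|.
Proof. by move=> PQ; apply: eq_card => i; rewrite !inE PQ. Qed.

Lemma card_set_const (T : finType) (P : pred T) (b : bool) :
  (forall i, P i = b) -> #|[set i | P i]| = b * #|T|.
Proof.
move=> Pb; case: b Pb => Pb.
  by rewrite mul1n -cardsT; apply: eq_card => i; rewrite !inE Pb.
by rewrite mul0n; apply: eq_card0 => i; rewrite inE Pb.
Qed.

Lemma split_lshift (m n : nat) (i : 'I_m) : split (lshift n i) = inl i.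
Proof. exact: (unsplitK (inl i)). Qed.

Lemma split_rshift (m n : nat) (i : 'I_n) : split (rshift m i) = inr i.
Proof. exact: (unsplitK (inr i)). Qed.

Lemma mem_score_set (U V : finType) (D : oriented_bigraph U V) (z : int) :
  (z \in score_set D) <->
  (exists u, z = scoreU D u) \/ (exists v, z = scoreV D v).
Proof.
rewrite /score_set mem_undup mem_cat; split.
  by case/orP=> /imageP[w _ ->]; [left | right]; exists w.
by case=> -[w ->]; apply/orP; [left | right]; apply: image_f.
Qed.

Section Layer.
Variables (p q x y : nat) (D : oriented_bigraph 'I_p 'I_q).

Definition layer_arcUV (u : 'I_(p + x)) (v : 'I_(q + y)) : bool :=
  match split u, split v with
  | inl u, inl v => arcUV D u v
  | inr _, inl _ => true
  | _, _ => false
  end.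

Definition layer_arcVU (v : 'I_(q + y)) (u : 'I_(p + x)) : bool :=
  match split v, split u with
  | inl v, inl u => arcVU D v u
  | inr _, inl _ => true
  | _, _ => false
  end.

Lemma layer_asym u v : ~~ (layer_arcUV u v && layer_arcVU v u).
Proof.
rewrite /layer_arcUV /layer_arcVU.
by case: (split u) (split v) => [u'|?] [v'|?] //; apply: arc_asym.
Qed.

Definition layer : oriented_bigraph 'I_(p + x) 'I_(q + y) :=
  OrientedBigraph layer_asym.

Let splitE := (split_lshift, split_rshift).

Lemma arcUV_old_old u v : arcUV layer (lshift x u) (lshift y v) = arcUV D u v.
Proof. by rewrite /arcUV /layer /layer_arcUV !splitE. Qed.

Lemma arcUV_old_new u v : arcUV layer (lshift x u) (rshift q v) = false.
Proof. by rewrite /arcUV /layer /layer_arcUV !splitE. Qed.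

Lemma arcUV_new_old u v : arcUV layer (rshift p u) (lshift y v) = true.
Proof. by rewrite /arcUV /layer /layer_arcUV !splitE. Qed.

Lemma arcUV_new_new u v : arcUV layer (rshift p u) (rshift q v) = false.
Proof. by rewrite /arcUV /layer /layer_arcUV !splitE. Qed.

Lemma arcVU_old_old v u : arcVU layer (lshift y v) (lshift x u) = arcVU D v u.
Proof. by rewrite /arcVU /layer /layer_arcVU !splitE. Qed.

Lemma arcVU_old_new v u : arcVU layer (lshift y v) (rshift p u) = false.
Proof. by rewrite /arcVU /layer /layer_arcVU !splitE. Qed.

Lemma arcVU_new_old v u : arcVU layer (rshift q v) (lshift x u) = true.
Proof. by rewrite /arcVU /layer /layer_arcVU !splitE. Qed.

Lemma arcVU_new_new v u : arcVU layer (rshift q v) (rshift p u) = false.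
Proof. by rewrite /arcVU /layer /layer_arcVU !splitE. Qed.

Lemma scoreU_layer_old u : scoreU layer (lshift x u) = scoreU D u.
Proof.
rewrite /scoreU /outdegU /indegU !card_set_split.
rewrite (eq_card_set _ _ _ (arcUV_old_old u)) (eq_card_set _ _ _ (arcVU_old_old^~ u)).
rewrite (card_set_const _ _ _ (arcUV_old_new u)).
rewrite (card_set_const _ _ _ (arcVU_new_old^~ u)) !card_ord.
rewrite -/(outdegU D u) -/(indegU D u); lia.
Qed.

(** The opposite part has size [q + y]; exactly its [q] old vertices are dominated, and the indegree
    is 0. *)
Lemma scoreU_layer_new u : scoreU layer (rshift p u) = Posz (2 * q + y).
Proof.
rewrite /scoreU /outdegU /indegU !card_set_split.
rewrite (card_set_const _ _ _ (arcUV_new_old u)).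
rewrite (card_set_const _ _ _ (arcVU_old_new^~ u)).
rewrite (card_set_const _ _ _ (arcUV_new_new u)).
rewrite (card_set_const _ _ _ (arcVU_new_new^~ u)) !card_ord; lia.
Qed.

Lemma scoreV_layer_old v : scoreV layer (lshift y v) = scoreV D v.
Proof.
rewrite /scoreV /outdegV /indegV !card_set_split.
rewrite (eq_card_set _ _ _ (arcVU_old_old v)) (eq_card_set _ _ _ (arcUV_old_old^~ v)).
rewrite (card_set_const _ _ _ (arcVU_old_new v)).
rewrite (card_set_const _ _ _ (arcUV_new_old^~ v)) !card_ord.
rewrite -/(outdegV D v) -/(indegV D v); lia.
Qed.

Lemma scoreV_layer_new v : scoreV layer (rshift q v) = Posz (2 * p + x).
Proof.
rewrite /scoreV /outdegV /indegV !card_set_split.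
rewrite (card_set_const _ _ _ (arcVU_new_old v)).
rewrite (card_set_const _ _ _ (arcUV_old_new^~ v)).
rewrite (card_set_const _ _ _ (arcVU_new_new v)).
rewrite (card_set_const _ _ _ (arcUV_new_new^~ v)) !card_ord; lia.
Qed.

(** Each score equation is required only when its side receives new vertices, so one-sided layers
    are covered; [0 < x + y] makes [s] actually occur. *)
Lemma score_set_layer (s : nat) :
  0 < x + y -> (0 < x -> s = 2 * q + y) -> (0 < y -> s = 2 * p + x) ->
  forall z, (z \in score_set layer) = (z \in score_set D) || (z == Posz s).
Proof.
move=> xy_gt0 sU sV z; apply/idP/idP.
  case/mem_score_set=> -[w ->]; case: (split_ordP w) => j ->.
  - by rewrite scoreU_layer_old; apply/orP; left; apply/mem_score_set; left; exists j.
  (* The index [j] of the new vertex itself witnesses [0 < x]. *)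
  - by rewrite scoreU_layer_new -sU ?eqxx ?orbT //; case: j => j /=; lia.
  - by rewrite scoreV_layer_old; apply/orP; left; apply/mem_score_set; right; exists j.
  - by rewrite scoreV_layer_new -sV ?eqxx ?orbT //; case: j => j /=; lia.
case/orP=> [/mem_score_set[] [w ->]|/eqP->]; apply/mem_score_set.
- by left; exists (lshift x w); rewrite scoreU_layer_old.
- by right; exists (lshift y w); rewrite scoreV_layer_old.
have [x_gt0|x_le0] := ltnP 0 x.
  by left; exists (rshift p (Ordinal x_gt0)); rewrite scoreU_layer_new -sU.
have y_gt0 : 0 < y by lia.
by right; exists (rshift q (Ordinal y_gt0)); rewrite scoreV_layer_new -sV.
Qed.

End Layer.

Definition arcless (U V : finType) : oriented_bigraph U V :=
  @OrientedBigraph U V (fun _ _ => false) (fun _ _ => false) (fun _ _ => isT).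

Lemma score_set_arcless (a : nat) :
  0 < a -> score_set (arcless 'I_a 'I_a) =i [:: Posz a].
Proof.
move=> a_gt0 z.
have sU u : scoreU (arcless 'I_a 'I_a) u = Posz a.
  by rewrite /scoreU /outdegU /indegU /= card_ord; lia.
have sV v : scoreV (arcless 'I_a 'I_a) v = Posz a.
  by rewrite /scoreV /outdegV /indegV /= card_ord; lia.
rewrite inE; apply/idP/eqP.
  by case/mem_score_set=> -[w ->]; rewrite ?sU ?sV.
by move=> ->; apply/mem_score_set; left; exists (Ordinal a_gt0).
Qed.

Definition geometric (a d n : nat) : seq int :=
  [seq Posz (a * d ^ i) | i <- iota 0 n.+1].

Lemma mem_geometricS (a d n : nat) (z : int) :
  (z \in geometric a d n.+1) =
  (z \in geometric a d n) || (z == Posz (a * d ^ n.+1)).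
Proof. by rewrite /geometric -[n.+2]addn1 iotaD map_cat mem_cat !inE. Qed.

(** The bounds are those needed to add a layer of score [a * d ^ n.+1]: the first two make the
    numbers of new vertices nonnegative, the third makes the layer nonempty. Positivity of [p] and
    [q] gives the strict bound on the next total, [2 * s - (p + q) < 2 * s]. *)
Definition extendable (a d n : nat) : Prop :=
  exists p q (D : oriented_bigraph 'I_p 'I_q),
    [/\ score_set D =i geometric a d n, 0 < p, 0 < q &
        [/\ 2 * p <= a * d ^ n.+1, 2 * q <= a * d ^ n.+1 &
            p + q < a * d ^ n.+1]].

Lemma extendableS (a d n : nat) :
  1 < d -> extendable a d n -> extendable a d n.+1.
Proof.
move=> d_gt1 [p [q [D [Dset p_gt0 q_gt0 []]]]].
set s := a * d ^ n.+1 => ps qs pqs.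
have sS : 2 * s <= a * d ^ n.+2.
  by rewrite [d ^ n.+2]expnSr mulnA -/s mulnC leq_mul.
(* The truncated subtractions are exact by [ps] and [qs], so the new parts have sizes [s - p] and
   [s - q]. *)
exists (p + (s - 2 * p)), (q + (s - 2 * q)), (layer _ _ (s - 2 * p) (s - 2 * q) D).
split; [|lia|lia|split; lia].
move=> z; rewrite mem_geometricS -Dset.
by apply: score_set_layer; lia.
Qed.

Lemma extendable_from (a d m n : nat) :
  1 < d -> m <= n -> extendable a d m -> extendable a d n.
Proof.
move=> d_gt1 /subnK <- ext; elim: (n - m) => // k IHk.
exact: extendableS.
Qed.

(** Two parts of size [a] satisfy the strict bound [a + a < a * d] exactly because [d] exceeds 2. *)
Lemma extendable0 (a d : nat) : 0 < a -> 2 < d -> extendable a d 0.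
Proof.
move=> a_gt0 d_gt2; exists a, a, (arcless _ _).
have ad : 3 * a <= a * d ^ 1 by rewrite expn1 mulnC leq_mul.
split=> //; last by split; lia.
by move=> z; rewrite score_set_arcless // !inE /= expn0 muln1.
Qed.

(** The [a] vertices added to U have score [2 * a + 0]. The parts become [2 * a] and [a], and the
    bounds hold as [4 * a <= 4 * a] and [3 * a < 4 * a]. *)
Lemma extendable1_base2 (a : nat) : 0 < a -> extendable a 2 1.
Proof.
move=> a_gt0; exists (a + a), (a + 0), (layer _ _ a 0 (arcless 'I_a 'I_a)).
split; [|lia|lia|split; lia].
move=> z; rewrite (@score_set_layer _ _ _ _ _ (a * 2 ^ 1)); try lia.
by rewrite score_set_arcless // mem_geometricS /geometric /= expn0 muln1.
Qed.

Theorem theorem2p3 (a d n : nat) (ha : (0 < a)%N) (hd : (1 < d)%N) :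
  exists (p q : nat) (D : oriented_bigraph 'I_p 'I_q),
    score_set D =i [seq Posz (a * d ^ i)%N | i <- iota 0 n.+1].
Proof.
case: n => [|n].
  (* The exponent 0 is treated apart since [extendable a 2 0] is false: all scores sum to
     [2 * p * q], so if all equal [a] then [p + q >= 2 * a]. *)
  exists a, a, (arcless _ _) => z.
  by rewrite score_set_arcless //= expn0 muln1.
suff [p [q [D [Dset _ _ _]]]] : extendable a d n.+1 by exists p, q, D.
have [d_gt2|d_le2] := ltnP 2 d.
  exact: extendable_from hd _ (extendable0 _ _ ha d_gt2).
have -> : d = 2 by lia.
by apply: extendable_from (extendable1_base2 _ ha).
Qed.
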